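(* Let $G$ be a finite non-nilpotent group. Then the intersection of the normalizers $N_G(P)$, where $P$ ranges over all non-normal Sylow subgroups of $G$ (for all primes dividing $|G|$), is nilpotent.
   Context: All groups are finite. A Sylow subgroup of $G$ means a Sylow $p$-subgroup of $G$ for some prime $p$ dividing $|G|$; it is non-normal if it is not a normal subgroup of $G$. $N_G(P)$ denotes the normalizer of $P$ in $G$. *)

From mathcomp Require Import all_boot all_fingroup all_solvable.

(** Let [D] be the intersection.  Every subgroup of [G] normalizes the normal
    Sylow subgroups of [G], so leaving them out of the family costs nothing: [D]
    normalizes all the Sylow subgroups of [G], and this alone makes it nilpotent
    ([norm_all_Sylows_nilpotent]).  Indeed a Sylow [p]-subgroup [P] of [G] is a
    normal Sylow subgroup of ['N_G(P)], which contains [D]; intersecting with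
    [D], one finds that [P :&: D] is a normal Sylow [p]-subgroup of [D].  So [D]
    has a normal Sylow subgroup for each prime, and is therefore nilpotent
    ([normal_Sylows_nilpotent]).

    The same criterion applied to [G] shows that a non-nilpotent [G] has a
    non-normal Sylow subgroup, so that the family is nonempty and [D] is
    contained in [G]. *)

Import GroupScope.

(** A normal Sylow [p]-subgroup is unique, and it is a nilpotent normal
    subgroup, so the Fitting subgroup contains all the Sylow subgroups.  These
    generate [G], which is then its own Fitting subgroup. *)
Lemma normal_Sylows_nilpotent (gT : finGroupType) (G : {group gT}) :
    (forall p : nat, exists2 P : {group gT}, p.-Sylow(G) P & P <| G) ->
  nilpotent G.
Proof.
move=> nSylG; apply: nilpotentS (Fitting_nil G).
rewrite -{1}(Sylow_gen G) gen_subG; apply/bigcupsP=> Q /SylowP[p _ sylQ].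
have [P sylP nsPG] := nSylG p.
have sQP : Q \subset P.
  by rewrite (sub_normal_Hall sylP nsPG) ?(pHall_sub sylQ) ?(pHall_pgroup sylQ).
apply: subset_trans sQP (Fitting_max nsPG _).
exact: pgroup_nil (pHall_pgroup sylP).
Qed.

(** Normal Hall subgroups, unlike arbitrary ones, can be intersected with any
    subgroup; hence the passage from [G] to ['N_G(P)], where [P] is normal. *)
Lemma norm_all_Sylows_nilpotent (gT : finGroupType) (G H : {group gT}) :
    (forall (p : nat) (P : {group gT}), p.-Sylow(G) P -> H \subset 'N_G(P)) ->
  nilpotent H.
Proof.
move=> nSylH; apply: normal_Sylows_nilpotent => p.
have [P sylP] := Sylow_exists p G.
have sHN := nSylH p P sylP.
have nsPN : P <| 'N_G(P) by rewrite normal_subnorm (pHall_sub sylP).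
have sylPN : p.-Sylow('N_G(P)) P.
  by apply: pHall_subl sylP; rewrite ?(normal_sub nsPN) ?subsetIl.
exists (P :&: H)%G; first exact: setI_normal_Hall nsPN sylPN sHN.
by rewrite /= setIC; apply: normalGI sHN nsPN.
Qed.

Theorem theorem1p3 (gT : finGroupType) (G : {group gT}) :
  ~~ nilpotent G ->
  nilpotent
    (\bigcap_(p <- primes #|G|)
       \bigcap_(P in 'Syl_p(G) | ~~ (P <| G)) 'N_G(P))%g.
Proof.
move=> nnilG; set D := (\bigcap_(p <- _) _)%g.
have sDN (p : nat) (P : {group gT}) :
  p.-Sylow(G) P -> ~~ (P <| G) -> D \subset 'N_G(P).
- move=> sylP nnP.
  (* A trivial Sylow subgroup is normal, so [p] is a prime divisor of [#|G|]. *)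
  have p_dv : p \in primes #|G|.
    apply: contraR nnP => p'G.
    suff /eqP-> : P :==: 1 by exact: normal1.
    by rewrite trivg_card1 (card_Hall sylP) p_part_eq1.
  rewrite /D (big_rem p p_dv); apply: subset_trans (subsetIl _ _) _.
  by apply: (bigcap_inf P); rewrite inE sylP.
have sDG : D \subset G.
  apply: contraR nnilG => nsDG; apply: normal_Sylows_nilpotent => p.
  have [P sylP] := Sylow_exists p G; exists P => //.
  apply: contraR nsDG => nnP.
  exact: subset_trans (sDN p P sylP nnP) (subsetIl _ _).
have gD : group_set D.
  by rewrite /D; elim/big_ind: _ => [|A B gA gB|q _]; try exact: groupP;
     exact: (groupP (group gA :&: group gB)).
apply: (norm_all_Sylows_nilpotent _ G (group gD)) => p P sylP.
have [nsPG | nnP] := boolP (P <| G); last exact: sDN sylP nnP.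
by rewrite subsetI sDG (subset_trans sDG) ?normal_norm.
Qed.
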